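(* Fix $\beta>0$. Let $(\tilde s_i,\tilde a_i,\tilde s_i')_{i\ge0}$ be random samples with $\tilde s_i,\tilde s_i'\in\mathcal S$, $\tilde a_i\in\mathcal A$, and $(\tilde\eta_i)_{i\ge0}$ nonnegative random step sizes, such that almost surely, for all $s'\in\mathcal S$ and $i\in\mathbb N$, $\mathbb P[\tilde s_i'=s'\mid\mathcal G_{i-1},\tilde s_i,\tilde a_i,\tilde\eta_i]=p(\tilde s_i,\tilde a_i,s')$, where $\mathcal G_{i-1}=(\tilde\eta_l,(\tilde s_l,\tilde a_l,\tilde s_l'))_{l=0}^{i-1}$; and such that for each $(s,a)\in\mathcal S\times\mathcal A$, $\sum_{i:(\tilde s_i,\tilde a_i)=(s,a)}\tilde\eta_i=\infty$ and $\sum_{i:(\tilde s_i,\tilde a_i)=(s,a)}\tilde\eta_i^2<\infty$ almost surely. Define iterates $\tilde q_i\in\mathbb R^{\mathcal S\times\mathcal A}$ by $\tilde q_0\equiv0$ and, for $i\ge0$, $\tilde z_i=r(\tilde s_i,\tilde a_i,\tilde s_i')+\max_{a'\in\mathcal A}\tilde q_i(\tilde s_i',a')-\tilde q_i(\tilde s_i,\tilde a_i)$, $\tilde q_{i+1}(\tilde s_i,\tilde a_i)=\tilde q_i(\tilde s_i,\tilde a_i)-\tilde\eta_i\,(e^{-\beta\tilde z_i}-1)$, and $\tilde q_{i+1}(s,a)=\tilde q_i(s,a)$ for $(s,a)\ne(\tilde s_i,\tilde a_i)$. If there are constants $z_{\min}\le z_{\max}$ with $\tilde z_i\in[z_{\min},z_{\max}]$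 for all $i$ almost surely, then $(\tilde q_i)$ converges almost surely to some $q_\infty$ satisfying $q_\infty=\hat B_\beta q_\infty$.
   Context: Setting: a finite MDP with state set $\mathcal S=\{1,\dots,S,e\}$, sink $e$ with $p(e,a,e)=1$, $r(e,a,e)=0$, finite action set $\mathcal A$, transition probabilities $p(s,a,s')$, rewards $r(s,a,s')$, transient under every stationary deterministic policy. $\ell_\beta(z)=\beta^{-1}(e^{-\beta z}-1)+z$ and $(\hat B_\beta q)(s,a)=\operatorname*{argmin}_{y\in\mathbb R}\mathbb E^{s,a}\big[\ell_\beta\big(r(s,a,\tilde s_1)+\max_{a'\in\mathcal A}q(\tilde s_1,a')-y\big)\big]$ with $\tilde s_1\sim p(s,a,\cdot)$. *)

(* Defs.v *)
From HB Require Import structures.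
From mathcomp Require Import all_boot all_order all_algebra.
From mathcomp Require Import all_classical all_reals all_analysis.
Set Implicit Arguments. Unset Strict Implicit. Unset Printing Implicit Defensive.
Import Order.TTheory GRing.Theory Num.Theory.
Import numFieldNormedType.Exports.
Local Open Scope classical_set_scope.
Local Open Scope ring_scope.

Section MDPDefs.
Variables (R : realType) (St A : finType) (a0 : A).

Definition qmax (q : St -> A -> R) (s : St) : R :=
  \big[Num.max/q s a0]_(a : A) q s a.

Definition ellb (beta z : R) : R := beta^-1 * (expR (- (beta * z)) - 1) + z.

Definition expLoss (p r : St -> A -> St -> R) (beta : R) (q : St -> A -> R)
    (s : St) (a : A) (y : R) : R :=
  \sum_(s1 : St) p s a s1 * ellb beta (r s a s1 + qmax q s1 - y).

Definition is_Bhat_value (p r : St -> A -> St -> R) (beta : R)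
    (q : St -> A -> R) (s : St) (a : A) (y : R) : Prop :=
  forall y' : R, expLoss p r beta q s a y <= expLoss p r beta q s a y'.

Definition Bhat_fixed_point (p r : St -> A -> St -> R) (beta : R)
    (q : St -> A -> R) : Prop :=
  forall s a, is_Bhat_value p r beta q s a (q s a).

Fixpoint Pn (p : St -> A -> St -> R) (pi : St -> A) (n : nat) (s t : St) : R :=
  match n with
  | 0 => if s == t then 1 else 0
  | n'.+1 => \sum_(u : St) p s (pi s) u * Pn p pi n' u t
  end.

Definition transient_MDP (p r : St -> A -> St -> R) (e : St) : Prop :=
  [/\ (forall s a s', 0 <= p s a s'),
      (forall s a, \sum_(s' : St) p s a s' = 1),
      (forall a, p e a e = 1),
      (forall a, r e a e = 0) &
      (forall (pi : St -> A) (s : St), Pn p pi n s e @[n --> \oo] --> (1 : R))].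

Fixpoint qiter (r : St -> A -> St -> R) (beta : R) (sv : nat -> St)
    (av : nat -> A) (sv' : nat -> St) (ev : nat -> R) (i : nat) : St -> A -> R :=
  match i with
  | 0 => fun _ _ => 0
  | i'.+1 =>
    let q := qiter r beta sv av sv' ev i' in
    let z := r (sv i') (av i') (sv' i') + qmax q (sv' i') - q (sv i') (av i') in
    fun s a => if (s == sv i') && (a == av i')
               then q s a - ev i' * (expR (- (beta * z)) - 1)
               else q s a
  end.

Definition ziter (r : St -> A -> St -> R) (beta : R) (sv : nat -> St)
    (av : nat -> A) (sv' : nat -> St) (ev : nat -> R) (i : nat) : R :=
  let q := qiter r beta sv av sv' ev i in
  r (sv i) (av i) (sv' i) + qmax q (sv' i) - q (sv i) (av i).

End MDPDefs.

Section Filtration.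
Variables (d : measure_display) (Omega : measurableType d) (R : realType)
  (St A : finType).

(* generators of sigma(G_{i-1}, s_i, a_i, eta_i) where
   G_{i-1} = (eta_l, (s_l, a_l, s'_l))_{l=0}^{i-1} *)
Definition gen_info (ss : nat -> Omega -> St) (aa : nat -> Omega -> A)
    (ss' : nat -> Omega -> St) (eta : nat -> Omega -> R) (i : nat)
    : set (set Omega) :=
  fun B =>
    (exists l x, (l <= i)%N /\ B = ss l @^-1` [set x]) \/
    (exists l x, (l <= i)%N /\ B = aa l @^-1` [set x]) \/
    (exists l x, (l < i)%N /\ B = ss' l @^-1` [set x]) \/
    (exists l (C : set R), (l <= i)%N /\ measurable C /\ B = eta l @^-1` C).

Definition info_sigma ss aa ss' eta i : set (set Omega) :=
  smallest (sigma_algebra setT) (gen_info ss aa ss' eta i).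

End Filtration.

(* Main.v *)
Require Import Defs.
From HB Require Import structures.
From mathcomp Require Import all_boot all_order all_algebra.
From mathcomp Require Import all_classical all_reals all_analysis.
From mathcomp Require Import measurable_realfun ring lra.
Import Order.TTheory GRing.Theory Num.Theory.
Import numFieldNormedType.Exports.
Local Open Scope classical_set_scope.
Local Open Scope ring_scope.

(** Write Phi q (s, a) for the conditional expectation of exp (- beta z) at (s, a); then
    q is a fixed point iff Phi q = 1 (from which optimality in the argmin follows by
    convexity of exp), and the update is a noisy step in the direction 1 - Phi q.

    Along almost every path the residuals of all possible successors are bounded at the
    visit times; transience propagates this from the sink to bounds on all the q-values,
    without any contraction. The noise is a transform of bounded martingale differences
    by predictable square-summable weights, so it sums to a finite limit. A scalar
    Robbins-Monro argument in each coordinate then shows that U = limsup q_i and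
    L = liminf q_i satisfy Phi U <= 1 <= Phi L, and both vanish at the sink.
    Finally Phi U <= 1 <= Phi L together with U <= L at the sink forces U <= L everywhere:
    a pair maximising U - L > 0 would propagate along the greedy policy of U, which would
    then never reach the sink. Hence U = L is the limit, and the same comparison shows
    that the fixed point, hence the limit, does not depend on the path. *)

(** * Comparison principle for transient MDPs *)

Section mdp.
Context {R : realType} {St A : finType} (a0 : A).
Implicit Types (q U L : St -> A -> R) (p r : St -> A -> St -> R).

Lemma le_qmax q s a : q s a <= qmax a0 q s.
Proof. exact: le_bigmax. Qed.

Lemma qmax_attained q s : exists a, qmax a0 q s = q s a.
Proof.
rewrite /qmax; elim/big_ind: _ => [|x y [a ->] [b ->]|a _]; first by exists a0.
- by rewrite maxEle; case: ifP => _; [exists b | exists a].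
- by exists a.
Qed.

Lemma qmax_le q s c : (forall a, q s a <= c) -> qmax a0 q s <= c.
Proof. by move=> h; have [a ->] := qmax_attained q s. Qed.

(* Under a policy that never leaves [Bad], the sink is never reached. *)
Lemma transient_closed_empty (p r : St -> A -> St -> R) e (Bad : St -> Prop) (pi : St -> A) :
  transient_MDP p r e -> ~ Bad e ->
  (forall s t, Bad s -> 0 < p s (pi s) t -> Bad t) -> forall s, ~ Bad s.
Proof.
move=> [p0 _ _ _ tr] Be cl s Bs.
have P0 n : forall u, Bad u -> Pn p pi n u e = 0.
  elim: n => [|n IH] u Bu /=; first by case: eqP => // ue; case: Be; rewrite -ue.
  apply: big1 => t _.
  have [p_gt0|] := ltP 0 (p u (pi u) t); first by rewrite (IH t) ?mulr0 //; exact: cl Bu p_gt0.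
  by move=> p_le0; rewrite (_ : p _ _ _ = 0) ?mul0r //; apply/eqP; rewrite eq_le p_le0 p0.
have := tr pi s; rewrite (_ : (fun n => _) = cst 0); last by apply/funext => n; exact: P0.
move=> /cvg_lim -/(_ (@Rhausdorff R)); rewrite lim_cst; last exact: Rhausdorff.
by move=> /eqP; rewrite eq_sym oner_eq0.
Qed.

(* The value of E[exp(-beta z)] at the state-action pair (s, a); it equals
   exp(beta (q s a - (Bhat q) s a)). *)
Definition expect_exp p r (beta : R) q s a : R :=
  \sum_(t : St) p s a t * expR (- (beta * (r s a t + qmax a0 q t - q s a))).

(** Up to terms free of [y], the loss is exp (beta (y - q s a)) / beta times [expect_exp], minus
    [y]. When [expect_exp] is 1 the inequality 1 + x <= exp x puts the minimum at [y = q s a]. *)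
Lemma Bhat_fixed_of_expect_exp p r beta q : 0 < beta ->
  (forall s a, \sum_t p s a t = 1) ->
  (forall s a, expect_exp p r beta q s a = 1) ->
  Bhat_fixed_point a0 p r beta q.
Proof.
move=> b0 p1 E1 s a y'.
have lossE y : expLoss a0 p r beta q s a y =
    beta^-1 * (expR (beta * (y - q s a)) * expect_exp p r beta q s a - 1)
    + (\sum_t p s a t * (r s a t + qmax a0 q t)) - y.
  (* Constants become averages under [p], so that the identity can be checked successor by
     successor. *)
  have pE x : x = \sum_t p s a t * x by rewrite -mulr_suml p1 mul1r.
  rewrite /expLoss /ellb /expect_exp mulrBr mulr_sumr mulr_sumr (pE (beta^-1 * 1)).
  rewrite [X in _ = _ - X]pE.
  rewrite -!(sumrB, big_split) /=; apply: eq_bigr => t _.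
  rewrite (_ : - (beta * (r s a t + qmax a0 q t - y)) =
    beta * (y - q s a) + - (beta * (r s a t + qmax a0 q t - q s a))); last by ring.
  by rewrite expRD; ring.
rewrite !lossE E1 subrr mulr0 expR0 !mulr1 subrr mulr0 add0r.
have := @expR_ge1Dx R (beta * (y' - q s a)).
rewrite -lerBrDl => h.
have : y' - q s a <= beta^-1 * (expR (beta * (y' - q s a)) - 1).
  by rewrite ler_pdivlMl.
lra.
Qed.

(* At a pair maximising U - L the two conditions force equality on the support of
   p, so that the maximisers are closed under the greedy policy of U. *)
Lemma sub_le_super (p r : St -> A -> St -> R) e beta U L : 0 < beta -> transient_MDP p r e ->
  (forall s a, expect_exp p r beta U s a <= 1) ->
  (forall s a, 1 <= expect_exp p r beta L s a) ->
  (forall a, U e a <= L e a) ->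
  forall s a, U s a <= L s a.
Proof.
move=> b0 tr sub sup le_e s a.
have [p0 p1 _ _ _] := tr.
rewrite leNgt; apply/negP => LU.
pose D (x : St * A) := U x.1 x.2 - L x.1 x.2.
have [x _ xmax] : exists2 x, true & forall y, true -> D y <= D x.
  case: (@arg_maxP _ _ _ (s, a) xpredT D erefl) => x _ h.
  by exists x.
set c := D x in xmax.
have c0 : 0 < c by apply: lt_le_trans (xmax (s, a) isT); rewrite subr_gt0.
have step s1 a1 t : U s1 a1 - L s1 a1 = c -> 0 < p s1 a1 t ->
    forall b, qmax a0 U t = U t b -> U t b - L t b = c.
  move=> Dc pt b Ub.
  have qle u : qmax a0 U u <= qmax a0 L u + c.
    apply: qmax_le => a'; have := xmax (u, a') isT; have := le_qmax L u a'.
    rewrite /D /=; lra.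
  have trm u : p s1 a1 u * expR (- (beta * (r s1 a1 u + qmax a0 L u - L s1 a1)))
            <= p s1 a1 u * expR (- (beta * (r s1 a1 u + qmax a0 U u - U s1 a1))).
    apply: ler_wpM2l => //; rewrite ler_expR lerN2 ler_pM2l //.
    have := qle u; lra.
  (* The terms for [L] are at most those for [U], yet the sums satisfy the reverse inequality
     through 1, so all terms agree. *)
  have /eqP sE : expect_exp p r beta L s1 a1 == expect_exp p r beta U s1 a1.
    rewrite eq_le; apply/andP; split; last exact: le_trans (sub _ _) (sup _ _).
    exact: ler_sum.
  have tE : p s1 a1 t * expR (- (beta * (r s1 a1 t + qmax a0 L t - L s1 a1)))
            = p s1 a1 t * expR (- (beta * (r s1 a1 t + qmax a0 U t - U s1 a1))).
    apply/eqP; rewrite eq_sym -subr_eq0.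
    have : \sum_u (p s1 a1 u * expR (- (beta * (r s1 a1 u + qmax a0 U u - U s1 a1))) -
                   p s1 a1 u * expR (- (beta * (r s1 a1 u + qmax a0 L u - L s1 a1)))) == 0.
      by rewrite sumrB subr_eq0; apply/eqP/esym.
    rewrite psumr_eq0; last by move=> u _; rewrite subr_ge0.
    by move=> /allP /(_ t); rewrite mem_index_enum => /(_ isT).
  (* Cancelling [p] and exp leaves [qmax U t = qmax L t + c]. Since [qmax L t] is at least [L t b],
     the gap at [(t, b)] is at least [c], hence exactly [c]. *)
  move: tE => /(mulfI (lt0r_neq0 pt)) /expR_inj /oppr_inj /(mulfI (lt0r_neq0 b0)) tE.
  have := xmax (t, b) isT; rewrite /D /= => ub.
  have := le_qmax L t b; lra.
have [g gP] := choice (qmax_attained U).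
have noBad u : U u (g u) - L u (g u) <> c.
  move: u; apply: (transient_closed_empty _ _ _ _ g tr); first by have := le_e (g e); lra.
  by move=> u t Uc pt; exact: step Uc pt _ (gP t).
(* The action of the maximiser [x] need not be greedy; one transition leads to a state whose greedy
   pair is a maximiser. *)
have /psumr_neq0P : forall t, true -> 0 <= p x.1 x.2 t by [].
rewrite p1 => /(_ (elimN eqP (oner_neq0 R))) [t pt]; apply: (noBad t); exact: step _ pt _ (gP t).
Qed.
End mdp.

(** * Scalar stochastic approximation *)

Section stochastic_approximation.
Context {R : realType}.

(* Subtracting the converging noise turns y into a sequence w that decreases by at
   least delta * a n above T; it enters the region below T + eps / 4 since the
   steps are not summable, and cannot climb back since they are small. *)
Lemma robbins_monro_upper (y a g d : nat -> R) (T C delta eps : R) :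
  0 < eps -> 0 < delta -> (forall n, 0 <= a n) ->
  (forall M, exists n, M <= series a n) -> a @ \oo --> (0 : R) ->
  cvgn (series d) ->
  (forall n, y n.+1 = y n + a n * g n + d n) ->
  (forall n, a n * g n <= a n * C) ->
  (\forall n \near \oo, T <= y n -> g n <= - delta) ->
  \forall n \near \oo, y n <= T + eps.
Proof.
move=> e0 d0 a0 adiv acvg dcvg yS gC gT.
have e4 : 0 < eps / 4 by lra.
set S := limn (series d).
pose w n := y n - series d n + S.
have : \forall n \near \oo, [/\ `|S - series d n| < eps / 4, a n * C < eps / 4 &
    T <= y n -> g n <= - delta].
  near=> n; split; near: n.
  - by have /cvgrPdist_lt : series d @ \oo --> S := dcvg; apply.
  - have /cvgrPdist_lt aC : (a n * C) @[n --> \oo] --> (0 : R).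
      by rewrite -(mul0r C); apply: cvgMl.
    have := aC _ e4; apply: filterS => n; rewrite sub0r normrN; exact/le_lt_trans/ler_norm.
  - exact: gT.
move=> [N _ NP].
have wS n : w n.+1 = w n + a n * g n by rewrite /w yS seriesSr; ring.
have wy n : (N <= n)%N -> w n - eps / 4 <= y n <= w n + eps / 4.
  move=> /NP [] /=; rewrite ltr_norml /w => /andP[h1 h2] _ _; apply/andP; split; lra.
have wdec n : (N <= n)%N -> T + eps / 4 <= w n -> w n.+1 <= w n - delta * a n.
  move=> Nn Tw; rewrite wS lerD2l.
  have [_ _ /(_ _) gd] := NP n Nn.
  have /andP [h _] := wy n Nn.
  have /gd {}gd : T <= y n by lra.
  have := ler_wpM2l (a0 n) gd; lra.
(* Entry by contradiction: if [w] stayed above T + eps / 2, it would descend by [delta] times the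
   unbounded partial sums of the steps. *)
have [n Nn wn] : exists2 n, (N <= n)%N & w n <= T + eps / 2.
  apply: contrapT => hw.
  have wbig n : (N <= n)%N -> T + eps / 4 <= w n.
    move=> Nn; rewrite leNgt; apply/negP => wlt; apply: hw; exists n => //; lra.
  have wle k : w (N + k)%N <= w N - delta * (series a (N + k)%N - series a N).
    elim: k => [|k IH]; first by rewrite addn0 subrr mulr0 subr0.
    rewrite addnS seriesSr; have := wdec (N + k)%N (leq_addr _ _) (wbig _ (leq_addr _ _)).
    lra.
  (* With this much step mass after [N], the descent brings [w n] down to at most T - delta. *)
  have [n nP] := adiv (series a N + (w N - T) / delta + 1).
  have adelta : (w N - T) / delta * delta = w N - T by rewrite divfK // gt_eqF.
  have Tw : 0 <= (w N - T) / delta.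
    by apply: divr_ge0; [have := wbig N (leqnn _); lra | exact: ltW].
  have Nn : (N <= n)%N.
    rewrite leqNgt; apply/negP => /ltnW nN.
    have : series a n <= series a N.
      by rewrite -subr_ge0 sub_series_geq //; apply: sumr_ge0.
    lra.
  have := wle (n - N)%N; rewrite subnKC //.
  have := wbig n Nn.
  have : 0 <= delta * (series a n - (series a N + (w N - T) / delta + 1)).
    by apply: mulr_ge0; lra.
  lra.
exists n => // m /= nm.
suff : w m <= T + eps / 2.
  by move=> wm; have /andP [_ h] := wy m (leq_trans Nn nm); lra.
elim: m nm => [|m IH]; first by move: wn; rewrite leqn0 => /[swap] /eqP ->.
rewrite leq_eqVlt => /predU1P [<- //|]; rewrite ltnS => nm.
have Nm := leq_trans Nn nm; have {}IH := IH nm.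
(* Above T + eps / 4 the sequence decreases; below it, one step adds less than eps / 4. *)
have [wT|wT] := leP (T + eps / 4) (w m).
  have := wdec _ Nm wT; have : 0 <= delta * a m by apply: mulr_ge0 => //; exact: ltW.
  lra.
rewrite wS; have [_ h _] := NP m Nm; have := gC m; lra.
Unshelve. all: by end_near.
Qed.

Lemma robbins_monro_lower (y a g d : nat -> R) (T C delta eps : R) :
  0 < eps -> 0 < delta -> (forall n, 0 <= a n) ->
  (forall M, exists n, M <= series a n) -> a @ \oo --> (0 : R) ->
  cvgn (series d) ->
  (forall n, y n.+1 = y n + a n * g n + d n) ->
  (forall n, - (a n * C) <= a n * g n) ->
  (\forall n \near \oo, y n <= T -> delta <= g n) ->
  \forall n \near \oo, T - eps <= y n.
Proof.
move=> e0 d0 a0 adiv acvg dcvg yS gC gT.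
have dN : cvgn (series (\- d)).
  rewrite (_ : series _ = \- series d); first exact: is_cvgN.
  by apply/funext => n; rewrite /series /= sumrN.
have := @robbins_monro_upper (\- y) a (\- g) (\- d) (- T) C delta eps e0 d0 a0 adiv acvg dN.
move=> h; have {h} : \forall n \near \oo, (\- y) n <= - T + eps.
  apply: h => [n|n|]; [by rewrite /= yS; ring | by rewrite /= mulrN lerNl; exact: gC|].
  by apply: filterS gT => n h; rewrite /= !lerN2.
by apply: filterS => n /=; lra.
Qed.

(** The infimum of the eventual upper bounds, described by the only two properties of the limsup
    that are used later. *)
Lemma bounded_limsup (u : nat -> R) (M : R) : (forall n, `|u n| <= M) ->
  exists U, (forall eps, 0 < eps -> \forall n \near \oo, u n <= U + eps) /\
    (forall T, (\forall n \near \oo, u n <= T) -> U <= T).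
Proof.
move=> uM; pose E := [set T | \forall n \near \oo, u n <= T].
have lbE : lbound E (- M).
  move=> T [n _ /(_ n (leqnn _))]; apply: le_trans.
  by have := uM n; rewrite ler_norml => /andP [].
have EM : E M by exists 0%N => // n _; exact: le_trans (ler_norm _) (uM n).
exists (inf E); split => [eps e0|T ET]; last by apply: ge_inf => //; exists (- M).
have [|T ET Tlt] := @inf_adherent _ E _ e0; first by split; [exists M | exists (- M)].
by apply: filterS ET => n /le_trans; apply; exact: ltW.
Qed.

Lemma bounded_liminf (u : nat -> R) (M : R) : (forall n, `|u n| <= M) ->
  exists L, (forall eps, 0 < eps -> \forall n \near \oo, L - eps <= u n) /\
    (forall T, (\forall n \near \oo, T <= u n) -> T <= L).
Proof.
move=> uM; have [|U [U1 U2]] := @bounded_limsup (\- u) M.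
  by move=> n; rewrite normrN.
exists (- U); split => [eps /U1|T hT]; first by apply: filterS => n /=; lra.
by rewrite lerNr; apply: U2; apply: filterS hT => n; rewrite /= lerN2.
Qed.

End stochastic_approximation.

(** * Convergence along one sample path *)

Section sample_path.
Context {R : realType} {St A : finType} (a0 : A) (e : St).
Context (p r : St -> A -> St -> R) (beta zmin zmax : R).
Context (sv : nat -> St) (av : nat -> A) (sv' : nat -> St) (ev : nat -> R).

Definition visit s a i := (sv i == s) && (av i == a).
Definition step s a i : R := if visit s a i then ev i else 0.

Local Notation q := (qiter a0 r beta sv av sv' ev).

(** Formed for every target [t], not just the sampled one, so that it is known before the draw at
    time [i]. *)
Definition exp_residual s a t i : R :=
  expR (- (beta * (r s a t + qmax a0 (q i) t - q i s a))).

(** The martingale difference of the event that [(s, a)] is visited and the draw is [t]. *)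
Definition innovation s a t i : R :=
  (visit s a i && (sv' i == t))%:R - p s a t * (visit s a i)%:R.

(** Drift plus noise. The noise is split over the targets [t], so that each summand is a predictable
    weight times one innovation. *)
Lemma qiterS s a i : q i.+1 s a =
  q i s a + step s a i * (1 - expect_exp a0 p r beta (q i) s a)
  - \sum_t step s a i * exp_residual s a t i * innovation s a t i.
Proof.
rewrite /= (eq_sym s) (eq_sym a) -/(visit s a i) /step /innovation.
case: ifP => /= v; last first.
  by rewrite mul0r addr0 big1 ?subr0 // => t _; rewrite !mul0r.
have -> : \sum_t ev i * exp_residual s a t i * ((sv' i == t)%:R - p s a t * 1) =
    ev i * (exp_residual s a (sv' i) i - expect_exp a0 p r beta (q i) s a).
  rewrite /expect_exp (bigD1 (sv' i)) //= [in RHS](bigD1 (sv' i)) //= eqxx.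
  rewrite (eq_bigr (fun t => - (ev i * (p s a t * exp_residual s a t i)))); last first.
    by move=> t; rewrite eq_sym => /negbTE ->; rewrite sub0r; ring.
  by rewrite sumrN -mulr_sumr /exp_residual mulr1n; ring.
move: v => /andP [/eqP <- /eqP <-]; rewrite /exp_residual; ring.
Qed.

Context (trans : transient_MDP p r e) (beta_gt0 : 0 < beta).
Context (ev_ge0 : forall i, 0 <= ev i).
Context (sample_supp : forall i, 0 < p (sv i) (av i) (sv' i)).
Context (residual_bounded : forall i t, 0 < p (sv i) (av i) t ->
  zmin <= r (sv i) (av i) t + qmax a0 (q i) t - q i (sv i) (av i) <= zmax).
Context (step_sum : forall s a M, exists n, M <= series (step s a) n).
Context (step_sq : forall s a, exists K, forall n,
  series (fun i => step s a i ^+ 2) n <= K).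
Context (noise_cvg : forall s a t,
  cvgn (series (fun i => step s a i * exp_residual s a t i * innovation s a t i))).

Let p0 : forall s a t, 0 <= p s a t. Proof. by have [] := trans. Qed.
Let p1 : forall s a, \sum_t p s a t = 1. Proof. by have [] := trans. Qed.

(** * Boundedness of the iterates along the path *)

Lemma step_ge0 s a i : 0 <= step s a i.
Proof. by rewrite /step; case: ifP. Qed.

(** At the sink the sampled successor must be the sink and the reward is 0, so the residual is 0 and
    the update changes nothing. *)
Lemma qiter_sink i a : q i e a = 0.
Proof.
elim: i a => [//|i IH] a /=; case: ifP => [/andP [/eqP es _]|_]; last exact: IH.
have [_ _ pe re _] := trans.
have es' : sv' i = e.
  apply/eqP/negPn/negP => ne.
  have := p1 e (av i); rewrite (bigD1 e) //= pe (bigD1 (sv' i)) //=.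
  have := sample_supp i; rewrite -es.
  have : 0 <= \sum_(t | (t != e) && (t != sv' i)) p e (av i) t by apply: sumr_ge0.
  lra.
have [b ->] := qmax_attained a0 (q i) (sv' i).
by rewrite -es es' !IH re !addr0 subrr mulr0 oppr0 expR0 subrr mulr0 subr0.
Qed.

Lemma step_cvg0 s a : step s a @ \oo --> (0 : R).
Proof.
have [K KP] := step_sq s a.
have : cvgn (series (fun i => step s a i ^+ 2)).
  apply: nondecreasing_is_cvgn; last by exists K => _ [n _ <-]; exact: KP.
  by apply: nondecreasing_series => i _ _; exact: sqr_ge0.
move=> /cvg_series_cvg_0 /cvgrPdist_lt h; apply/cvgrPdist_lt => eps e0.
have := h _ (exprn_gt0 2 e0); apply: filterS => n.
rewrite !sub0r !normrN normrX ltr_pXn2r // ?nnegrE ?normr_ge0 // ltW //.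
Qed.

Lemma step_le s a : exists2 H, 0 <= H & forall i, step s a i <= H.
Proof.
have [K KP] := step_sq s a.
(* A nonnegative step whose square is at most [K] is at most 1 + K. *)
exists (1 + K) => [|i].
  by have := KP 0%N; rewrite /series /= big_geq //; lra.
have := KP i.+1; rewrite seriesSr => h.
have : 0 <= series (fun j => step s a j ^+ 2) i by apply: sumr_ge0 => j _; exact: sqr_ge0.
have := step_ge0 s a i; nra.
Qed.

(** For z >= zmin the value exp (- beta z) lies between 0 and exp (- beta zmin), so this bounds its
    distance to 1. *)
Definition residual_bound : R := 1 + expR (- (beta * zmin)).

Lemma expR_residual_le z : zmin <= z <= zmax ->
  `|expR (- (beta * z)) - 1| <= residual_bound.
Proof.
move=> /andP [zl _]; rewrite ler_norml /residual_bound.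
have : expR (- (beta * z)) <= expR (- (beta * zmin)).
  by rewrite ler_expR lerN2 ler_pM2l.
have := expR_gt0 (- (beta * z)); lra.
Qed.

Lemma qiter_step_le s a i : `|q i.+1 s a - q i s a| <= step s a i * residual_bound.
Proof.
rewrite /= (eq_sym s) (eq_sym a) -/(visit s a i) /step.
case: ifP => /= v; last by rewrite subrr normr0 mul0r.
rewrite addrAC subrr add0r normrN normrM ger0_norm // ler_wpM2l //.
exact/expR_residual_le/residual_bounded.
Qed.

(** Between visits the value is frozen, and a visit moves it by at most [H * residual_bound] from a
    value at least [c]; the 0 in the minimum is the initial value. *)
Lemma qiter_ge s a c : (forall i, visit s a i -> c <= q i s a) ->
  exists c', forall i, c' <= q i s a.
Proof.
move=> h; have [H H0 HP] := step_le s a.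
exists (Num.min 0 (c - H * residual_bound)); elim=> [|i IH]; first by rewrite ge_min lexx.
have := qiter_step_le s a i; rewrite {1}/step.
case: ifP => v; last by rewrite mul0r normr_le0 subr_eq0 => /eqP ->.
rewrite ler_norml => /andP [h1 _]; rewrite ge_min; apply/orP; right.
have := h i v; have := HP i; rewrite /step v => h2 h3.
have : ev i * residual_bound <= H * residual_bound.
  by apply: ler_wpM2r => //; have := expR_gt0 (- (beta * zmin)); rewrite /residual_bound; lra.
lra.
Qed.

Lemma qiter_le s a c : (forall i, visit s a i -> q i s a <= c) ->
  exists c', forall i, q i s a <= c'.
Proof.
move=> h; have [H H0 HP] := step_le s a.
exists (Num.max 0 (c + H * residual_bound)); elim=> [|i IH]; first by rewrite le_max lexx.
have := qiter_step_le s a i; rewrite {1}/step.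
case: ifP => v; last by rewrite mul0r normr_le0 subr_eq0 => /eqP ->.
rewrite ler_norml => /andP [_ h1]; rewrite le_max; apply/orP; right.
have := h i v; have := HP i; rewrite /step v => h2 h3.
have : ev i * residual_bound <= H * residual_bound.
  by apply: ler_wpM2r => //; have := expR_gt0 (- (beta * zmin)); rewrite /residual_bound; lra.
lra.
Qed.

(* The upper bound on the residuals bounds q s a below as soon as some successor of
   (s, a) has a value bounded below. *)
Lemma qiter_bounded_below s a : exists c, forall i, c <= q i s a.
Proof.
pose Lo u := exists c, forall i, c <= qmax a0 (q i) u.
have propag u b t : 0 < p u b t -> Lo t -> exists c, forall i, c <= q i u b.
  move=> pt [c cP]; apply: (@qiter_ge _ _ (r u b t + c - zmax)) => i.
  move=> /andP [/eqP su /eqP ab]; have := @residual_bounded i t.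
  rewrite su ab => /(_ pt) /andP [_]; have := cP i; lra.
have LoP u : Lo u.
  (* One action bounded below suffices for [Lo], so a state outside [Lo] has all its successors
     outside [Lo] under every action, and any fixed policy serves. *)
  apply: contrapT; apply: (transient_closed_empty _ _ _ (fun u => ~ Lo u) (fun=> a0) trans).
    by apply; exists 0 => i; rewrite -(qiter_sink i a0) le_qmax.
  move=> {}u t nLo pt Lot; apply: nLo; have [c cP] := propag _ _ _ pt Lot.
  by exists c => i; exact: le_trans (cP i) (le_qmax a0 (q i) u a0).
have /psumr_neq0P : forall t, true -> 0 <= p s a t by [].
rewrite p1 => /(_ (elimN eqP (oner_neq0 R))) [t pt].
exact: propag pt (LoP t).
Qed.

(** Here [qmax] is bounded only if every action is. A state outside [Up] therefore has some action
    with all possible successors outside [Up]; the policy [g] choosing it would never reach the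
    sink. *)
Lemma qiter_bounded_above s a : exists c, forall i, q i s a <= c.
Proof.
pose Up u := exists c, forall i, qmax a0 (q i) u <= c.
have propag u b t : 0 < p u b t -> Up t -> exists c, forall i, q i u b <= c.
  move=> pt [c cP]; apply: (@qiter_le _ _ (r u b t + c - zmin)) => i.
  move=> /andP [/eqP su /eqP ab]; have := @residual_bounded i t.
  rewrite su ab => /(_ pt) /andP [+ _]; have := cP i; lra.
have UpS u : (forall b, exists2 t, 0 < p u b t & Up t) -> Up u.
  move=> h; have /choice [c cP] : forall b, exists c, forall i, q i u b <= c.
    by move=> b; have [t pt Ut] := h b; exact: propag pt Ut.
  exists (\big[Num.max/c a0]_b c b) => i; apply: qmax_le => b.
  by apply: le_trans (cP b i) _; exact: le_bigmax.
have UpP u : Up u.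
  apply: contrapT.
  have /choice [g gP] : forall u, exists b, ~ Up u -> forall t, 0 < p u b t -> ~ Up t.
    move=> v; apply: contrapT => /forallNP h; have Uv : Up v.
      apply: UpS => b; apply: contrapT => nt; apply: (h b) => _ t pt Ut.
      by apply: nt; exists t.
    by apply: (h a0) => /(_ Uv).
  apply: (transient_closed_empty _ _ _ (fun u => ~ Up u) g trans).
    apply; exists 0 => i; apply: qmax_le => b; by rewrite qiter_sink.
  by move=> {}u t nUp pt; exact: gP nUp _ pt.
have [c cP] := UpP s; exists c => i; exact: le_trans (le_qmax _ _ _ _) (cP i).
Qed.

Lemma qiter_bounded s a : exists M, forall i, `|q i s a| <= M.
Proof.
have [l lP] := qiter_bounded_below s a; have [u uP] := qiter_bounded_above s a.
exists (Num.max (- l) u) => i; rewrite ler_norml lerNl le_max le_max.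
by rewrite lerN2 lP uP orbT.
Qed.

(** * Inequalities for the limsup and liminf along the path *)

Lemma expect_exp_visit_le s a i : visit s a i ->
  expect_exp a0 p r beta (q i) s a <= expR (- (beta * zmin)).
Proof.
move=> /andP [/eqP <- /eqP <-].
have -> : expR (- (beta * zmin)) = \sum_t p (sv i) (av i) t * expR (- (beta * zmin)).
  by rewrite -mulr_suml p1 mul1r.
apply: ler_sum => t _; have [pt|pt] := ltP 0 (p (sv i) (av i) t); last first.
  by rewrite (_ : p _ _ _ = 0) ?mul0r //; apply/eqP; rewrite eq_le pt p0.
apply: ler_wpM2l => //; rewrite ler_expR lerN2 ler_pM2l //.
by have /andP [] := residual_bounded i t pt.
Qed.

Let noise s a i := - \sum_t step s a i * exp_residual s a t i * innovation s a t i.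

Let noise_sum_cvg s a : cvgn (series (noise s a)).
Proof.
rewrite (_ : series _ = (fun n => - \sum_t series (fun i =>
    step s a i * exp_residual s a t i * innovation s a t i) n)); last first.
  by apply/funext => n; rewrite /series /= /noise sumrN exchange_big.
apply: is_cvgN; apply/cvg_ex; exists (\sum_t limn (series (fun i =>
  step s a i * exp_residual s a t i * innovation s a t i))).
by apply: cvg_big => [|t _]; [exact: add_continuous | exact: noise_cvg].
Qed.

(** The drift is at most 1 because [expect_exp] is nonnegative, whence the constant 1 in the
    Robbins-Monro bound. *)
Lemma qiter_limsup_le s a T delta eps : 0 < eps -> 0 < delta ->
  (\forall i \near \oo, T <= q i s a -> 1 + delta <= expect_exp a0 p r beta (q i) s a) ->
  \forall i \near \oo, q i s a <= T + eps.
Proof.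
move=> e0 d0 h.
apply: (@robbins_monro_upper R (fun i => q i s a) (step s a)
  (fun i => 1 - expect_exp a0 p r beta (q i) s a) (noise s a) T 1 delta eps) => //.
- exact: step_ge0.
- exact: step_cvg0.
- by move=> i; rewrite qiterS.
- move=> i; apply: ler_wpM2l; first exact: step_ge0.
  rewrite lerBlDr lerDl; apply: sumr_ge0 => t _; apply: mulr_ge0 => //; exact: expR_ge0.
- by apply: filterS h => i hi /hi; lra.
Qed.

Lemma qiter_liminf_ge s a T delta eps : 0 < eps -> 0 < delta ->
  (\forall i \near \oo, q i s a <= T -> expect_exp a0 p r beta (q i) s a <= 1 - delta) ->
  \forall i \near \oo, T - eps <= q i s a.
Proof.
move=> e0 d0 h.
apply: (@robbins_monro_lower R (fun i => q i s a) (step s a)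
  (fun i => 1 - expect_exp a0 p r beta (q i) s a) (noise s a) T residual_bound delta eps) => //.
- exact: step_ge0.
- exact: step_cvg0.
- by move=> i; rewrite qiterS.
(* The drift is controlled from below only at visits; elsewhere the step is 0. *)
- move=> i; rewrite -mulrN /step; case: ifP => v; last by rewrite !mul0r.
  apply: ler_wpM2l => //; have := expect_exp_visit_le _ _ _ v; rewrite /residual_bound; lra.
- by apply: filterS h => i hi /hi; lra.
Qed.

Lemma qmax_limsup_le (U : St -> A -> R) :
  (forall s a eps, 0 < eps -> \forall i \near \oo, q i s a <= U s a + eps) ->
  forall eps, 0 < eps ->
    \forall i \near \oo, forall t, qmax a0 (q i) t <= qmax a0 U t + eps.
Proof.
move=> UP eps e0.
apply: filter_forall => t.
have : \forall i \near \oo, forall a, q i t a <= U t a + eps.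
  by apply: filter_forall => a; exact: UP.
apply: filterS => i h; apply: qmax_le => a; apply: le_trans (h a) _.
by rewrite lerD2r le_qmax.
Qed.

Lemma qmax_liminf_ge (L : St -> A -> R) :
  (forall s a eps, 0 < eps -> \forall i \near \oo, L s a - eps <= q i s a) ->
  forall eps, 0 < eps ->
    \forall i \near \oo, forall t, qmax a0 L t - eps <= qmax a0 (q i) t.
Proof.
move=> LP eps e0.
apply: filter_forall => t; have [b ->] := qmax_attained a0 L t.
apply: filterS (LP t b eps e0) => i h; exact: le_trans h (le_qmax _ _ _ _).
Qed.

(** Suppose the value [E] at [U] exceeds 1. Once [qmax q] is at most [qmax U + eps], any time with
    [q s a] above U s a - 2 eps has residuals at most 3 eps above those of [U], so [expect_exp]
    still exceeds 1 by a fixed amount. Robbins-Monro then gives the eventual bound U s a - eps,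
    against minimality of [U]. *)
Lemma expect_exp_limsup (U : St -> A -> R) :
  (forall s a eps, 0 < eps -> \forall i \near \oo, q i s a <= U s a + eps) ->
  (forall s a T, (\forall i \near \oo, q i s a <= T) -> U s a <= T) ->
  forall s a, expect_exp a0 p r beta U s a <= 1.
Proof.
move=> UP Umin s a; rewrite leNgt; apply/negP => E1.
set E := expect_exp _ _ _ _ _ _ _ in E1.
have E0 : 0 < E by lra.
have lnE : 0 < ln E by exact: ln_gt0.
(* Then exp (- 3 beta eps) * E = exp (ln E / 4), which is above 1. *)
set eps := ln E / (4 * beta).
have eps0 : 0 < eps by apply: divr_gt0 => //; apply: mulr_gt0.
have epsE : 4 * (beta * eps) = ln E by rewrite /eps; field; exact: lt0r_neq0.
clearbody eps.
have d0 : 0 < expR (- (beta * (3 * eps))) * E - 1.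
  rewrite subr_gt0 -[X in _ * X](lnK E0) -expRD -[ltLHS]expR0 ltr_expR.
  have : 0 < beta * eps by exact: mulr_gt0.
  by move: epsE; lra.
have : \forall i \near \oo, q i s a <= U s a - 2 * eps + eps.
  apply: (qiter_limsup_le s a (U s a - 2 * eps) _ eps eps0 d0).
  have := qmax_limsup_le U UP eps eps0; apply: filterS => i h Tq.
  rewrite addrC subrK /E /expect_exp mulr_sumr; apply: ler_sum => t _.
  rewrite mulrCA -expRD; apply: ler_wpM2l => //.
  rewrite ler_expR -opprD lerN2 -mulrDr ler_pM2l //.
  by have := h t; lra.
by move=> /Umin; lra.
Qed.

(** Mirror image of [expect_exp_limsup]. Positivity of [E], needed to write it as exp (ln E), comes
    from a successor of positive probability. *)
Lemma expect_exp_liminf (L : St -> A -> R) :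
  (forall s a eps, 0 < eps -> \forall i \near \oo, L s a - eps <= q i s a) ->
  (forall s a T, (\forall i \near \oo, T <= q i s a) -> T <= L s a) ->
  forall s a, 1 <= expect_exp a0 p r beta L s a.
Proof.
move=> LP Lmax s a; rewrite leNgt; apply/negP => E1.
set E := expect_exp _ _ _ _ _ _ _ in E1.
have E0 : 0 < E.
  rewrite lt_neqAle sumr_ge0 ?andbT; last by move=> t _; rewrite mulr_ge0 ?expR_ge0.
  rewrite eq_sym psumr_neq0; last by move=> t _; rewrite mulr_ge0 ?expR_ge0.
  have /psumr_neq0P : forall t, true -> 0 <= p s a t by [].
  rewrite p1 => /(_ (elimN eqP (oner_neq0 R))) [t pt].
  by apply/hasP; exists t; rewrite ?mem_index_enum //= mulr_gt0 ?expR_gt0.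
have lnE : ln E < 0 by apply: ln_lt0; rewrite E0.
set eps := - ln E / (4 * beta).
have eps0 : 0 < eps by apply: divr_gt0; rewrite ?oppr_gt0 // mulr_gt0.
have epsE : 4 * (beta * eps) = - ln E by rewrite /eps; field; exact: lt0r_neq0.
clearbody eps.
have d0 : 0 < 1 - expR (beta * (3 * eps)) * E.
  rewrite subr_gt0 -[X in _ * X](lnK E0) -expRD -[ltRHS]expR0 ltr_expR.
  have : 0 < beta * eps by exact: mulr_gt0.
  by move: epsE; lra.
have : \forall i \near \oo, L s a + 2 * eps - eps <= q i s a.
  apply: (qiter_liminf_ge s a (L s a + 2 * eps) _ eps eps0 d0).
  have := qmax_liminf_ge L LP eps eps0; apply: filterS => i h Tq.
  rewrite opprB addrC subrK /E /expect_exp mulr_sumr; apply: ler_sum => t _.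
  rewrite [leRHS]mulrCA -expRD; apply: ler_wpM2l => //.
  rewrite ler_expR -mulrN -[in leRHS]mulrN -mulrDr ler_pM2l //.
  by have := h t; lra.
by move=> /Lmax; lra.
Qed.

Theorem qiter_cvg : exists qinf : St -> A -> R,
  [/\ forall s a, expect_exp a0 p r beta qinf s a = 1,
      forall a, qinf e a = 0 &
      forall s a, q i s a @[i --> \oo] --> qinf s a].
Proof.
have /choice [M MP] : forall x : St * A, exists M, forall i, `|q i x.1 x.2| <= M.
  by move=> x; exact: qiter_bounded.
have /choice [U' UP'] := fun x => bounded_limsup _ _ (MP x).
have /choice [L' LP'] := fun x => bounded_liminf _ _ (MP x).
pose U s a := U' (s, a); pose L s a := L' (s, a).
have U1 s a eps : 0 < eps -> \forall i \near \oo, q i s a <= U s a + eps.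
  exact: (UP' (s, a)).1.
have U2 s a T : (\forall i \near \oo, q i s a <= T) -> U s a <= T.
  exact: (UP' (s, a)).2.
have L1 s a eps : 0 < eps -> \forall i \near \oo, L s a - eps <= q i s a.
  exact: (LP' (s, a)).1.
have L2 s a T : (\forall i \near \oo, T <= q i s a) -> T <= L s a.
  exact: (LP' (s, a)).2.
have Ue a : U e a <= 0 by apply: U2; exists 0%N => // i _; rewrite qiter_sink.
have Le a : 0 <= L e a by apply: L2; exists 0%N => // i _; rewrite qiter_sink.
have sub := expect_exp_limsup U U1 U2.
have sup := expect_exp_liminf L L1 L2.
have UL : forall s a, U s a <= L s a.
  apply: (sub_le_super a0 p r e beta U L) => // a; exact: le_trans (Ue a) (Le a).
have LU s a : L s a <= U s a.
  apply/ler_addgt0Pr => eps e0; have e2 : 0 < eps / 2 by lra.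
  have [i /= [h1 h2]] := @filter_ex _ \oo _ _ (filterI (U1 s a _ e2) (L1 s a _ e2)).
  lra.
have ULE : U = L.
  by apply/funext => s; apply/funext => a; apply/eqP; rewrite eq_le UL LU.
exists U; split => [s a|a|s a].
- by apply/eqP; rewrite eq_le sub ULE sup.
- by apply/eqP; rewrite eq_le Ue ULE Le.
apply/cvgrPdist_le => eps e0; near=> i.
have : q i s a <= U s a + eps by near: i; exact: U1.
have : U s a - eps <= q i s a by rewrite ULE; near: i; exact: L1.
by rewrite ler_norml; lra.
Unshelve. all: by end_near.
Qed.

End sample_path.

(** * Almost sure convergence of martingale transforms *)

Section bounded_expectation.
Context {d : measure_display} {T : measurableType d} {R : realType}
  (P : probability T R).

Definition bounded_measurable (f : T -> R) :=
  measurable_fun setT f /\ exists M : R, forall w, `|f w| <= M.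

Lemma bounded_measurable_integrable f :
  bounded_measurable f -> P.-integrable setT (EFin \o f).
Proof.
move=> [mf [M fM]]; apply: measurable_bounded_integrable => //.
  exact: le_lt_trans (probability_le1 P measurableT) (ltry 1).
exists M; split; first exact: num_real.
by move=> x Mx w _; exact: le_trans (fM w) (ltW Mx).
Qed.

Lemma bounded_measurableD f g : bounded_measurable f -> bounded_measurable g ->
  bounded_measurable (fun w => f w + g w).
Proof.
move=> [mf [M fM]] [mg [N gN]]; split; first exact: measurable_funD.
by exists (M + N) => w; apply: le_trans (ler_normD _ _) _; exact: lerD.
Qed.

Lemma bounded_measurableM f g : bounded_measurable f -> bounded_measurable g ->
  bounded_measurable (fun w => f w * g w).
Proof.
move=> [mf [M fM]] [mg [N gN]]; split; first exact: measurable_funM.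
by exists (M * N) => w; rewrite normrM ler_pM.
Qed.

Lemma bounded_measurable_cst c : bounded_measurable (fun=> c).
Proof. by split => //; exists `|c|. Qed.

Lemma bounded_measurable_indic (A : set T) : measurable A ->
  bounded_measurable (\1_A : T -> R).
Proof.
move=> mA; split; first exact: measurable_indic.
by exists 1 => w; rewrite indicE; case: (w \in A); rewrite ?normr1 // normr0.
Qed.

Lemma bounded_measurable_sum (n : nat) (f : nat -> T -> R) :
  (forall i, bounded_measurable (f i)) ->
  bounded_measurable (fun w => \sum_(0 <= i < n) f i w).
Proof.
move=> h; elim: n => [|n IH].
  rewrite (_ : (fun _ => _) = (fun=> 0)); first exact: bounded_measurable_cst.
  by apply/funext => w; rewrite big_geq.
rewrite (_ : (fun _ => _) = (fun w => \sum_(0 <= i < n) f i w + f n w)).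
  exact: bounded_measurableD.
by apply/funext => w; rewrite big_nat_recr.
Qed.

(* The laws of f under the two measures agree away from 0, where the integrands vanish. *)
Lemma ge0_integral_cond_indep (f : T -> R) (E F : set T) (c : R) :
  measurable_fun setT f -> (forall w, 0 <= f w) -> measurable E -> measurable F -> 0 <= c ->
  (forall C, measurable C -> P (f @^-1` C `&` E) = (c%:E * P (f @^-1` C `&` F))%E) ->
  (\int[P]_w (f w * \1_E w)%R%:E = c%:E * \int[P]_w (f w * \1_F w)%R%:E)%E.
Proof.
move=> mf f0 mE mF c0 h.
have mI A : measurable A -> measurable_fun setT (fun w => f w * \1_A w).
  by move=> mA; apply: measurable_funM => //; exact: measurable_indic.
pose X A mA : {mfun T >-> R} := HB.pack (fun w => f w * \1_A w)
  (isMeasurableFun.Build _ _ _ _ _ (mI A mA)).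
pose D : set R := ~` [set 0].
have mD : measurable D by exact: measurableC.
have step A (mA : measurable A) : (\int[P]_w (f w * \1_A w)%R%:E =
   \int[distribution P (X A mA)]_(y in D) `|y|%:E)%E.
  rewrite ge0_integral_pushforward //; last first.
  - by apply/measurable_EFinP; apply: measurable_funTS; exact: normr_measurable.
  rewrite [RHS]integral_mkcond; apply: eq_integral => w _ /=; rewrite patchE.
  have fI0 : 0 <= f w * \1_A w by rewrite mulr_ge0 // indicE; case: (w \in A).
  case: ifPn; first by rewrite /= ger0_norm.
  by rewrite notin_setE /D /= => /contrapT ->.
rewrite (step E mE) (step F mF).
pose cn := NngNum c0.
transitivity (\int[mscale cn (distribution P (X F mF))]_(y in D) `|y|%:E)%E.
  apply: eq_measure_integral => C mC CD.
  have pre A : (fun w => f w * \1_A w) @^-1` C = f @^-1` C `&` A.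
    apply/seteqP; split => w /=; rewrite indicE.
      case: (boolP (w \in A)); rewrite ?mulr1 ?mulr0; first by rewrite inE.
      by move=> _ /CD /(_ erefl).
    by move=> [fC wA]; rewrite mem_set // mulr1.
  transitivity (P (f @^-1` C `&` E)); first by rewrite -(pre E).
  by rewrite h // -(pre F).
rewrite ge0_integral_mscale //.
apply/measurable_EFinP; apply: measurable_funTS; exact: normr_measurable.
Qed.

(** A signed [f] is handled by subtracting the nonnegative case for the constant [M] from that for
    [f + M], where [M] bounds [|f|]. *)
Lemma expectation_cond_indep (f : T -> R) (E F : set T) (c : R) :
  bounded_measurable f -> measurable E -> measurable F -> 0 <= c ->
  (forall C, measurable C -> P (f @^-1` C `&` E) = (c%:E * P (f @^-1` C `&` F))%E) ->
  \int[P]_w (f w * (\1_E w - c * \1_F w)) = 0.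
Proof.
move=> bf mE mF c0 h; have [mf [M fM]] := bf.
have bE := bounded_measurable_indic _ mE.
have bF := bounded_measurable_indic _ mF.
have cond g : bounded_measurable g -> (forall w, 0 <= g w) ->
  (forall C, measurable C -> P (g @^-1` C `&` E) = (c%:E * P (g @^-1` C `&` F))%E) ->
  \int[P]_w (g w * \1_E w) = c * \int[P]_w (g w * \1_F w).
  move=> bg g0 hg; have [mg _] := bg.
  rewrite /Rintegral (ge0_integral_cond_indep g E F c) //.
  rewrite fineM //; apply: integrable_fin_num => //.
  exact: (bounded_measurable_integrable _ (bounded_measurableM _ _ bg bF)).
have bM := bounded_measurable_cst M.
have bfM := bounded_measurableD _ _ bf bM.
have h1 := cond _ bfM; have h2 := cond _ bM.
have M0 (w : T) : 0 <= M by exact: le_trans (normr_ge0 (f w)) (fM w).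
have {}h1 : \int[P]_w ((f w + M) * \1_E w) = c * \int[P]_w ((f w + M) * \1_F w).
  apply: h1 => [w|C mC].
    by rewrite -lerBlDr sub0r; have := fM w; rewrite ler_norml => /andP [].
  have -> : (fun w => f w + M) @^-1` C = f @^-1` ((fun x => x + M) @^-1` C) by [].
  apply: h; rewrite -[X in measurable X]setTI.
  exact: (measurable_funD _ (measurable_cst M)).
have {}h2 : \int[P]_w (M * \1_E w) = c * \int[P]_w (M * \1_F w).
  apply: h2 => [w|C mC]; first exact: M0 w.
  have [CM|CM] := pselect (C M).
    have e : (fun=> M) @^-1` C = setT :> set T by apply/seteqP; split.
    by have := h setT measurableT; rewrite preimage_setT e.
  have -> : (fun=> M) @^-1` C = set0 :> set T by apply/seteqP; split.
  by rewrite !set0I measure0 mule0.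
have int1 A : measurable A -> P.-integrable setT (EFin \o (fun w => (f w + M) * \1_A w)).
  move=> mA; apply: bounded_measurable_integrable; apply: bounded_measurableM => //.
  exact: bounded_measurable_indic.
have int2 A : measurable A -> P.-integrable setT (EFin \o (fun w => M * \1_A w)).
  move=> mA; apply: bounded_measurable_integrable; apply: bounded_measurableM => //.
  exact: bounded_measurable_indic.
have split_f A : measurable A -> \int[P]_w (f w * \1_A w) =
    \int[P]_w ((f w + M) * \1_A w) - \int[P]_w (M * \1_A w).
  move=> mA; rewrite -RintegralB //; last 2 first.
  - exact: int1.
  - exact: int2.
  by apply: eq_Rintegral => w _; rewrite mulrDl addrK.
have intf A : measurable A -> P.-integrable setT (EFin \o (fun w => f w * \1_A w)).
  move=> mA; apply: bounded_measurable_integrable; apply: bounded_measurableM => //.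
  exact: bounded_measurable_indic.
transitivity (\int[P]_w (f w * \1_E w) - c * \int[P]_w (f w * \1_F w)).
  rewrite -RintegralZl //; last exact: intf.
  rewrite -RintegralB //; last 2 first.
  - exact: intf.
  - apply: (bounded_measurable_integrable (fun w => c * (f w * \1_F w))).
    apply: bounded_measurableM; first exact: bounded_measurable_cst.
    exact: bounded_measurableM.
  by apply: eq_Rintegral => w _; ring.
rewrite !split_f // h1 h2; ring.
Qed.

End bounded_expectation.

Section martingale_transform.
Context {d : measure_display} {T : measurableType d} {R : realType}
  (P : probability T R).
Context (G : nat -> set (set T)).
Context (G_measurable : forall i A, <<s G i >> A -> measurable A).
Context (G_increasing : forall i A, <<s G i >> A -> <<s G i.+1 >> A).
Context (E F : nat -> set T) (c : R).
Context (E_sub : forall i, E i `<=` F i).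
Context (F_info : forall i, <<s G i >> (F i)) (E_info : forall i, <<s G i.+1 >> (E i)).
Context (c_ge0 : 0 <= c) (c_le1 : c <= 1).
Context (cond_prob : forall i B, <<s G i >> B ->
  P (B `&` E i) = (c%:E * P (B `&` F i))%E).

(** [G i] is the information before draw [i]: a weight adapted at [i] is predictable for [mdiff i],
    which is itself adapted at [i.+1]. *)
Definition adapted (i : nat) (f : T -> R) :=
  measurable_fun [set: g_sigma_algebraType (G i)] (f : g_sigma_algebraType (G i) -> R).

Definition mdiff i w : R := \1_(E i) w - c * \1_(F i) w.

Lemma adaptedS i f : adapted i f -> adapted i.+1 f.
Proof. by move=> mf _ C mC; apply: G_increasing; exact: mf. Qed.

Lemma adapted_measurable i f : adapted i f -> measurable_fun setT f.
Proof. by move=> mf _ C mC; apply: (G_measurable i); exact: mf. Qed.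

Lemma adapted_mdiff i : adapted i.+1 (mdiff i).
Proof.
apply: measurable_funB.
  exact: (@measurable_indic _ (g_sigma_algebraType (G i.+1)) R setT (E i) (E_info i)).
apply: measurable_funM => //.
exact: (@measurable_indic _ (g_sigma_algebraType (G i.+1)) R setT (F i)
  (G_increasing _ _ (F_info i))).
Qed.

Lemma mdiff_le1 i w : `|mdiff i w| <= 1.
Proof.
rewrite /mdiff !indicE ler_norml; have := @E_sub i w.
case: (boolP (w \in E i)); rewrite ?inE ?notin_setE => wE h.
  by rewrite (mem_set (h wE)) mulr1n; move: c_ge0 c_le1; lra.
by case: (w \in F i); rewrite ?mulr1n ?mulr0n; move: c_ge0 c_le1; lra.
Qed.

Let measE i : measurable (E i). Proof. exact: G_measurable (E_info i). Qed.
Let measF i : measurable (F i). Proof. exact: G_measurable (F_info i). Qed.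

Lemma expectation_mdiff i f : adapted i f -> bounded_measurable f ->
  \int[P]_w (f w * mdiff i w) = 0.
Proof.
move=> mf bf; apply: expectation_cond_indep => // C mC.
by apply: cond_prob; rewrite -[X in <<s _ >> X]setTI; exact: mf.
Qed.

Section square_bounded.
Context (h : nat -> T -> R) (K : R).
Context (h_adapted : forall i, adapted i (h i)).
Context (h_sq : forall n w, series (fun i => h i w ^+ 2) n <= K).

Let S n w := series (fun i => h i w * mdiff i w) n.

Let h_bounded i : bounded_measurable (h i).
Proof.
split; first exact: adapted_measurable (h_adapted i).
exists (1 + K) => w; have := h_sq i.+1 w; rewrite seriesSr.
have : 0 <= series (fun j => h j w ^+ 2) i by apply: sumr_ge0 => j _; exact: sqr_ge0.
by rewrite ler_norml; nra.
Qed.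

Let mdiff_bounded i : bounded_measurable (mdiff i).
Proof.
split; first exact: adapted_measurable (adapted_mdiff i).
by exists 1 => w; exact: mdiff_le1.
Qed.

Section oscillation.
Context (eps : R) (eps_gt0 : 0 < eps).

(* The partial sums, restarted from 0 each time they have left (-eps, eps). A restart
   discards eps ^ 2 of the second moment, which the increments feed by at most K in
   total, so the probabilities of the escapes are summable. *)
Fixpoint restarted n w : R :=
  if n is n'.+1 then
    (if `|restarted n' w| < eps then restarted n' w else 0) + h n' w * mdiff n' w
  else 0.

Let kept n w : R := if `|restarted n w| < eps then restarted n w else 0.
Let escape n : set T := [set w | ~~ (`|restarted n w| < eps)].

Let adapted_kept n : adapted n (restarted n) -> adapted n (kept n).
Proof.
move=> mV; apply: (@measurable_fun_ifT _ _ (g_sigma_algebraType (G n))) => //.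
apply: (@measurable_fun_ltr _ (g_sigma_algebraType (G n))) => //.
by apply: measurableT_comp => //; exact: normr_measurable.
Qed.

Let adapted_restarted n : adapted n (restarted n).
Proof.
elim: n => [|n IH]; first exact: measurable_cst.
apply: measurable_funD; first by apply: (adaptedS n (kept n)); exact: adapted_kept.
by apply: measurable_funM; [exact: (adaptedS n (h n) (h_adapted n)) | exact: adapted_mdiff].
Qed.

Let kept_bounded n : bounded_measurable (kept n).
Proof.
split; first exact: (adapted_measurable n _ (adapted_kept n (adapted_restarted n))).
exists eps => w; rewrite /kept; case: ifP => [/ltW //|_].
by rewrite normr0 ltW.
Qed.

Let restarted_bounded n : bounded_measurable (restarted n).
Proof.
case: n => [|n]; first exact: bounded_measurable_cst.
apply: bounded_measurableD; first exact: kept_bounded.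
exact: bounded_measurableM.
Qed.

Let escape_measurable n : measurable (escape n).
Proof.
have mV : measurable_fun setT (fun w => `|restarted n w| < eps).
  apply: measurable_fun_ltr => //; apply: measurableT_comp => //.
  exact: (adapted_measurable n _ (adapted_restarted n)).
have -> : escape n = setT `&` (fun w => `|restarted n w| < eps) @^-1` [set false].
  by rewrite setTI; apply/seteqP; split => w; rewrite /escape /=; [move/negbTE | move->].
exact: mV.
Qed.

Let intP f (bf : bounded_measurable f) := bounded_measurable_integrable P f bf.

(** By induction: the cross term has mean 0 since [kept n * h n] is adapted at [n], the new square
    is at most [h n ^+ 2] as [|mdiff| <= 1], and passing from [restarted] to [kept] loses at least
    eps ^ 2 on [escape n]. *)
Let energy n : \int[P]_w (restarted n w ^+ 2) +
    \sum_(0 <= i < n) eps ^+ 2 * \int[P]_w (\1_(escape i) w) <=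
  \int[P]_w (series (fun i => h i w ^+ 2) n).
Proof.
have bsq (f : T -> R) : bounded_measurable f -> bounded_measurable (fun w => f w ^+ 2).
  by move=> bf; exact: (bounded_measurableM _ _ bf bf).
have bI i : bounded_measurable (\1_(escape i) : T -> R).
  exact: bounded_measurable_indic.
have bc (x : R) : bounded_measurable (fun _ : T => x) := bounded_measurable_cst x.
elim: n => [|n IH].
  rewrite big_geq // addr0; apply: le_Rintegral => //; [| |].
  - exact: (intP _ (bsq _ (restarted_bounded 0%N))).
  - by apply: intP; apply: bounded_measurable_sum => i; exact: bsq.
  - by move=> w _; rewrite /series /= big_geq // expr0n.
rewrite big_nat_recr //=.
have -> : \int[P]_w (series (fun i => h i w ^+ 2) n.+1) =
    \int[P]_w (series (fun i => h i w ^+ 2) n) + \int[P]_w (h n w ^+ 2).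
  rewrite -RintegralD //; last 2 first.
  - by apply: intP; apply: bounded_measurable_sum => i; exact: bsq.
  - by apply: intP; exact: bsq.
  by apply: eq_Rintegral => w _; rewrite seriesSr.
have -> : \int[P]_w ((kept n w + h n w * mdiff n w) ^+ 2) =
   \int[P]_w (kept n w ^+ 2 + (h n w * mdiff n w) ^+ 2).
  transitivity (\int[P]_w ((kept n w ^+ 2 + (h n w * mdiff n w) ^+ 2)
      + 2 * (kept n w * h n w * mdiff n w))).
    by apply: eq_Rintegral => w _; ring.
  rewrite RintegralD //; last 2 first.
  - by apply: intP; apply: bounded_measurableD; apply: bsq => //; exact: bounded_measurableM.
  - apply: intP; apply: bounded_measurableM => //.
    by apply: bounded_measurableM => //; exact: bounded_measurableM.
  rewrite RintegralZl //; last first.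
    by apply: intP; apply: bounded_measurableM => //; exact: bounded_measurableM.
  rewrite expectation_mdiff ?mulr0 ?addr0 //; last exact: bounded_measurableM.
  by apply: measurable_funM; [exact: adapted_kept | exact: h_adapted].
have : \int[P]_w (kept n w ^+ 2 + (h n w * mdiff n w) ^+ 2) +
    \int[P]_w (eps ^+ 2 * \1_(escape n) w) <=
    \int[P]_w (restarted n w ^+ 2) + \int[P]_w (h n w ^+ 2).
  have bl : bounded_measurable (fun w => kept n w ^+ 2 + (h n w * mdiff n w) ^+ 2).
    by apply: bounded_measurableD; apply: bsq => //; exact: bounded_measurableM.
  have be : bounded_measurable (fun w => eps ^+ 2 * \1_(escape n) w).
    exact: bounded_measurableM.
  have br := bsq _ (restarted_bounded n).
  have bh := bsq _ (h_bounded n).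
  rewrite -[leLHS](RintegralD measurableT (intP _ bl) (intP _ be)).
  rewrite -[leRHS](RintegralD measurableT (intP _ br) (intP _ bh)).
  apply: le_Rintegral => //; [| |].
  - exact: (intP _ (bounded_measurableD _ _ bl be)).
  - exact: (intP _ (bounded_measurableD _ _ br bh)).
  move=> w _.
  have h1 : (h n w * mdiff n w) ^+ 2 <= h n w ^+ 2.
    rewrite exprMn ler_piMr ?sqr_ge0 // -real_normK ?num_real //.
    by rewrite expr_le1 ?normr_ge0 //; exact: mdiff_le1.
  have h2 : kept n w ^+ 2 + eps ^+ 2 * \1_(escape n) w <= restarted n w ^+ 2.
    rewrite /kept indicE; case: ifP => hV.
      by rewrite memNset ?mulr0 ?addr0 //= /escape /= hV.
    rewrite mem_set /escape /= ?hV // expr0n add0r mulr1.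
    rewrite -[leRHS]real_normK ?num_real // ler_pXn2r ?nnegrE ?normr_ge0 ?(ltW eps_gt0) //.
    by rewrite leNgt hV.
  lra.
rewrite RintegralZl //; last by exact: intP.
rewrite addrA; move: IH.
set x1 := \int[P]_w (restarted n w ^+ 2); set x2 := \sum_(0 <= i < n) _.
lra.
Qed.

(** By [energy] the probabilities of the escapes sum to at most K / eps ^ 2; Borel-Cantelli leaves
    finitely many escapes on almost every path. *)
Lemma restarted_ae_small : {ae P, forall w,
  exists m, forall n, (m <= n)%N -> `|restarted n w| < eps}.
Proof.
have PE i : P (escape i) = (\int[P]_w (\1_(escape i) w))%:E.
  rewrite /Rintegral fineK; first by rewrite integral_indic // setIT.
  by apply: integrable_fin_num => //; apply: intP; exact: bounded_measurable_indic.
have PleK n : \sum_(0 <= i < n) \int[P]_w (\1_(escape i) w) <= K / eps ^+ 2.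
  rewrite ler_pdivlMr ?exprn_gt0 // mulrC mulr_sumr.
  have := energy n.
  have : 0 <= \int[P]_w (restarted n w ^+ 2).
    by apply: Rintegral_ge0 => w _; exact: sqr_ge0.
  have : \int[P]_w (series (fun i => h i w ^+ 2) n) <= K.
    rewrite -[leRHS]mulr1 -[X in K * X](_ : fine (P setT) = 1); last by rewrite probability_setT.
    rewrite -Rintegral_cst //; apply: le_Rintegral => //.
    - apply: intP; apply: bounded_measurable_sum => i.
      exact: (bounded_measurableM _ _ (h_bounded i) (h_bounded i)).
    - by apply: intP; exact: bounded_measurable_cst.
  lra.
have : P (lim_sup_set escape) = 0%E.
  apply: lim_sup_set_cvg0 => //.
  apply: (@le_lt_trans _ _ (K / eps ^+ 2)%:E); last exact: ltry.
  apply: lime_le; first by apply: is_cvg_nneseries.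
  near=> n; rewrite (eq_bigr (fun i => (\int[P]_w (\1_(escape i) w))%:E)); last first.
    by move=> i _; exact: PE.
  by rewrite sumEFin lee_fin.
move=> P0; exists (lim_sup_set escape); split => //.
  apply: bigcap_measurable => // k _; exact: bigcup_measurable.
move=> w /= nw k _; apply: contrapT => hk; apply: nw.
exists k => n /= kn; apply: contrapT => hn; apply: hk.
by exists n => //=; exact/negP.
Unshelve. all: by end_near.
Qed.

Lemma ae_small_oscillation : {ae P, forall w,
  exists m, forall n, (m <= n)%N -> `|S n w - S m w| < 2 * eps}.
Proof.
apply: filterS restarted_ae_small => w [m mP]; exists m => n mn.
(* After the last escape there are no restarts, so both sequences have the same increments. *)
have VE : restarted n w - restarted m w = S n w - S m w.
  elim: n mn => [|n IH]; first by rewrite leqn0 => /eqP ->; rewrite !subrr.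
  rewrite leq_eqVlt => /predU1P [<-|]; first by rewrite !subrr.
  rewrite ltnS => mn; rewrite {1}/S seriesSr /= mP // -/(S n w).
  by have := IH mn; lra.
rewrite -VE; apply: le_lt_trans (ler_normB _ _) _.
by have := mP n mn; have := mP m (leqnn m); lra.
Qed.

End oscillation.

Lemma ae_cvg_square_bounded : {ae P, forall w, cvgn (S^~ w)}.
Proof.
have : {ae P, forall w, forall k : nat,
    exists m, forall n, (m <= n)%N -> `|S n w - S m w| < 2 * k.+1%:R^-1}.
  by apply: ae_foralln => k; apply: ae_small_oscillation; rewrite invr_gt0.
apply: filterS => w hw; apply/cauchy_cvgP; apply: cauchy_exP => e e0.
have e2 : 0 < e / 2 by lra.
have [k ke] := ltr_add_invr e2.
have [m mP] := hw k; exists (S m w); exists m => // n /= mn.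
rewrite -ball_normE /= distrC; apply: lt_trans (mP n mn) _.
by move: ke; rewrite add0r -ltr_pdivlMl // mulrC.
Qed.

End square_bounded.

Lemma adapted_le i j f : (i <= j)%N -> adapted i f -> adapted j f.
Proof.
move=> ij mf; elim: j ij => [|j IH]; first by rewrite leqn0 => /eqP <-.
by rewrite leq_eqVlt => /predU1P [<- //|]; rewrite ltnS => /IH; exact: adaptedS.
Qed.

(** Localisation: the bound on the squares depends on the path, so weights are cut off once their
    squares sum beyond [k]. On a path with bound [K <= k] nothing is cut off, and countably many [k]
    cover almost every path. *)
Theorem ae_cvg_martingale_transform (h : nat -> T -> R) :
  (forall i, adapted i (h i)) ->
  {ae P, forall w, exists K, forall n, series (fun i => h i w ^+ 2) n <= K} ->
  {ae P, forall w, cvgn (series (fun i => h i w * mdiff i w))}.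
Proof.
move=> h_adapted h_sq.
pose Q n w : R := series (fun i => h i w ^+ 2) n.
(* [Q i.+1] involves only [h 0] to [h i], so the cut-off weight is still adapted at [i], and the
   square that would cross [k] is already excluded. *)
pose hK (k i : nat) w : R := if Q i.+1 w <= k%:R then h i w else 0.
have Q_adapted i : adapted i (Q i.+1).
  rewrite /adapted /Q.
  rewrite (_ : (fun _ => _) = (fun w => \sum_(j < i.+1) h j w ^+ 2)); last first.
    by apply/funext => w; rewrite /series /= big_mkord.
  apply: measurable_sum => j; apply: measurable_funX.
  by apply: (adapted_le j i) => //; rewrite -ltnS.
have hK_adapted k i : adapted i (hK k i).
  apply: (@measurable_fun_ifT _ _ (g_sigma_algebraType (G i))) => //; last exact: h_adapted.
  apply: (@measurable_fun_ler _ (g_sigma_algebraType (G i))); first exact: Q_adapted.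
  exact: measurable_cst.
have hK_sq k n w : series (fun i => hK k i w ^+ 2) n <= k%:R.
  (* The comparison with [Q] is what carries the bound by [k] through a step that keeps its
     weight. *)
  suff : series (fun i => hK k i w ^+ 2) n <= k%:R /\
    series (fun i => hK k i w ^+ 2) n <= Q n w by case.
  elim: n => [|n [IH1 IH2]]; first by rewrite /Q /series /= !big_geq.
  rewrite /Q !seriesSr -/(Q n w) /hK; case: ifP => hQ.
    by move: hQ; rewrite /Q seriesSr -/(Q n w) => hQ; split; lra.
  by rewrite expr0n addr0; split => //; apply: le_trans IH2 _; rewrite lerDl sqr_ge0.
have : {ae P, forall w, forall k, cvgn (series (fun i => hK k i w * mdiff i w))}.
  by apply: ae_foralln => k; exact: (ae_cvg_square_bounded (hK k) k%:R).
apply: filterS2 h_sq => w [K KP] hcvg.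
have [k Kk] : exists k : nat, K <= k%:R.
  exists (Num.bound `|K|).
  exact: le_trans (ler_norm K) (ltW (archi_boundP (normr_ge0 K))).
rewrite (_ : (fun i => _) = (fun i => hK k i w * mdiff i w)); first exact: hcvg.
by apply/funext => i; rewrite /hK ifT //; exact: le_trans (KP _) Kk.
Qed.

End martingale_transform.

(** * Q-learning *)

Section eseries_real.
Context {R : realType} (u : nat -> R) (vis : pred nat).

Let masked i : R := if vis i then u i else 0.

Let eseriesE n : (\sum_(0 <= i < n | vis i) (u i)%:E)%E = (series masked n)%:E.
Proof. by rewrite sumEFin big_mkcond. Qed.

Lemma series_unbounded_of_eseries : (forall i, 0 <= u i) ->
  (\sum_(i <oo | vis i) (u i)%:E = +oo)%E ->
  forall M, exists n, M <= series masked n.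
Proof.
move=> u0 uoo M; apply: contrapT => /forallNP hM.
suff : (\sum_(i <oo | vis i) (u i)%:E <= M%:E)%E by rewrite uoo leye_eq.
apply: lime_le; first by apply: is_cvg_nneseries_cond => i _ _; rewrite lee_fin.
near=> n; rewrite eseriesE lee_fin leNgt; apply/negP => /ltW; exact: hM.
Unshelve. all: by end_near.
Qed.

Lemma series_bounded_of_eseries : (forall i, 0 <= u i) ->
  (\sum_(i <oo | vis i) (u i)%:E < +oo)%E ->
  exists K, forall n, series masked n <= K.
Proof.
move=> u0 ufin; exists (fine (\sum_(i <oo | vis i) (u i)%:E)%E) => n.
rewrite -lee_fin fineK; last first.
  by rewrite ge0_fin_numE //; apply: nneseries_ge0 => i _ _; rewrite lee_fin.
rewrite -eseriesE; apply: nneseries_lim_ge => i _ _; by rewrite lee_fin.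
Qed.

End eseries_real.

(** States and actions are plain finite types with no sigma-algebra, so dependence on them is
    resolved by a finite sum of indicators. *)
Lemma measurable_fun_fincase {d : measure_display} {T : measurableType d} {R : realType}
    {I : finType} (X : T -> I) (f : I -> T -> R) :
  (forall x, measurable (X @^-1` [set x])) ->
  (forall x, measurable_fun setT (f x)) ->
  measurable_fun setT (fun w => f (X w) w).
Proof.
move=> mX mf.
rewrite (_ : (fun w => _) = (fun w => \sum_(x : I) \1_(X @^-1` [set x]) w * f x w)).
  apply: measurable_sum => x; apply: measurable_funM => //; exact: measurable_indic.
apply/funext => w; rewrite (bigD1 (X w)) //= big1 => [|x xw].
  by rewrite indicE mem_set // mul1r addr0.
by rewrite indicE memNset ?mul0r //= => Xx; rewrite Xx eqxx in xw.
Qed.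

Lemma measurable_fun_qmax {d : measure_display} {T : measurableType d} {R : realType}
    {St A : finType} (a0 : A) (q : T -> St -> A -> R) (s : St) :
  (forall a, measurable_fun setT (fun w => q w s a)) ->
  measurable_fun setT (fun w => qmax a0 (q w) s).
Proof.
move=> mq; rewrite /qmax.
elim: (index_enum A) => [|a l IH].
  by rewrite (_ : (fun w => _) = (fun w => q w s a0)) //; apply/funext => w; rewrite big_nil.
rewrite (_ : (fun w => _) = (fun w => Num.max (q w s a)
  (\big[Num.max/q w s a0]_(b <- l) q w s b))); first exact: measurable_maxr.
by apply/funext => w; rewrite big_cons.
Qed.

Section q_learning.
Context {R : realType} {St A : finType} (e : St) (a0 : A).
Context (p r : St -> A -> St -> R) (beta : R).
Context {d : measure_display} {Omega : measurableType d} (P : probability Omega R).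
Context (ss : nat -> Omega -> St) (aa : nat -> Omega -> A).
Context (ss' : nat -> Omega -> St) (eta : nat -> Omega -> R) (zmin zmax : R).
Context (trans : transient_MDP p r e) (beta_gt0 : 0 < beta).
Context (mss : forall i x, measurable (ss i @^-1` [set x])).
Context (maa : forall i x, measurable (aa i @^-1` [set x])).
Context (mss' : forall i x, measurable (ss' i @^-1` [set x])).
Context (meta : forall i, measurable_fun setT (eta i)).
Context (eta_ge0 : forall i w, 0 <= eta i w).
Context (cond_prob : forall i s' B, info_sigma ss aa ss' eta i B ->
  P (B `&` (ss' i @^-1` [set s'])) =
  (\int[P]_(w in B) (p (ss i w) (aa i w) s')%:E)%E).
Context (eta_sum : forall s a, {ae P, forall w,
  (\sum_(i <oo | (ss i w == s) && (aa i w == a)) (eta i w)%:E = +oo)%E}).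
Context (eta_sq : forall s a, {ae P, forall w,
  (\sum_(i <oo | (ss i w == s) && (aa i w == a)) ((eta i w) ^+ 2)%:E < +oo)%E}).
Context (z_bounded : {ae P, forall w, forall i,
  zmin <= ziter a0 r beta (ss^~ w) (aa^~ w) (ss'^~ w) (eta^~ w) i <= zmax}).

Let G i : set (set Omega) := gen_info ss aa ss' eta i.
Let q i w := qiter a0 r beta (ss^~ w) (aa^~ w) (ss'^~ w) (eta^~ w) i.
Let p0 : forall s a t, 0 <= p s a t. Proof. by have [] := trans. Qed.
Let p1 : forall s a, \sum_t p s a t = 1. Proof. by have [] := trans. Qed.

(** * Measurability with respect to the information before each draw *)

Lemma info_measurable i B : <<s G i >> B -> measurable B.
Proof.
apply: smallest_sub; first exact: sigma_algebra_measurable.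
move=> _ [[l [x [_ ->]]]|[[l [x [_ ->]]]|[[l [x [_ ->]]]|[l [C [_ [mC ->]]]]]]] //.
by rewrite -[X in measurable X]setTI; exact: meta.
Qed.

Lemma info_increasing i B : <<s G i >> B -> <<s G i.+1 >> B.
Proof.
apply: sub_sigma_algebra2 => C; rewrite /G /gen_info.
move=> [[l [x [li ->]]]|[[l [x [li ->]]]|[[l [x [li ->]]]|[l [D [li [mD ->]]]]]]].
- by left; exists l, x; rewrite leqW.
- by right; left; exists l, x; rewrite leqW.
- by right; right; left; exists l, x; rewrite leqW.
- by right; right; right; exists l, D; rewrite leqW.
Qed.

Lemma info_ss i s : <<s G i >> (ss i @^-1` [set s]).
Proof. by apply: sub_sigma_algebra; left; exists i, s. Qed.

Lemma info_aa i a : <<s G i >> (aa i @^-1` [set a]).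
Proof. by apply: sub_sigma_algebra; right; left; exists i, a. Qed.

Lemma info_ss' i s : <<s G i.+1 >> (ss' i @^-1` [set s]).
Proof. by apply: sub_sigma_algebra; right; right; left; exists i, s. Qed.

Lemma adapted_eta i : adapted G i (eta i).
Proof.
move=> _ C mC; rewrite setTI; apply: sub_sigma_algebra.
by right; right; right; exists i, C.
Qed.

Let visit_set s a i : set Omega := ss i @^-1` [set s] `&` aa i @^-1` [set a].

Lemma info_visit s a i : <<s G i >> (visit_set s a i).
Proof.
exact: (@measurableI _ (g_sigma_algebraType (G i)) _ _ (info_ss i s) (info_aa i a)).
Qed.

Let trans_set s a t i : set Omega := visit_set s a i `&` ss' i @^-1` [set t].

Lemma info_trans s a t i : <<s G i.+1 >> (trans_set s a t i).
Proof.
exact: (@measurableI _ (g_sigma_algebraType (G i.+1)) _ _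
  (info_increasing _ _ (info_visit s a i)) (info_ss' i t)).
Qed.

(** On the visit event the integrand of the conditional law is the constant [p s a t], which gives
    the form required of the martingale differences. *)
Lemma cond_prob_visit s a t i B : <<s G i >> B ->
  P (B `&` trans_set s a t i) = ((p s a t)%:E * P (B `&` visit_set s a i))%E.
Proof.
move=> iB; have iBF : <<s G i >> (B `&` visit_set s a i).
  exact: (@measurableI _ (g_sigma_algebraType (G i)) _ _ iB (info_visit s a i)).
rewrite /trans_set setIA (cond_prob i t _ iBF).
rewrite (eq_integral (cst (p s a t)%:E)); last first.
  by move=> w; rewrite inE => -[_ [/= su ab]] /=; rewrite su ab.
by rewrite integral_cst //; exact: info_measurable iBF.
Qed.

Lemma adapted_q i s a : adapted G i (fun w => q i w s a).
Proof.
elim: i s a => [|i IH] s a; first exact: measurable_cst.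
have IH' s1 a1 : adapted G i.+1 (fun w => q i w s1 a1).
  exact: (adaptedS G info_increasing i _ (IH s1 a1)).
(* For each value of this triple the update is a fixed measurable expression, and the triple is
   known in [G i.+1]. *)
pose X w := (ss i w, aa i w, ss' i w).
pose f (x : St * A * St) w : R := if (s == x.1.1) && (a == x.1.2)
  then q i w s a - eta i w * (expR (- (beta * (r x.1.1 x.1.2 x.2 + qmax a0 (q i w) x.2
    - q i w x.1.1 x.1.2))) - 1) else q i w s a.
apply: (@measurable_fun_fincase _ (g_sigma_algebraType (G i.+1)) R _ X f).
  move=> [[u b] t]; rewrite (_ : X @^-1` _ = trans_set u b t i); first exact: info_trans.
  apply/seteqP; split => w; rewrite /X /trans_set /visit_set /=.
    by case=> -> -> ->.
  by move=> [[-> ->] ->].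
move=> [[u b] t]; rewrite /f /=; case: ((s == u) && (a == b)); last exact: IH'.
apply: measurable_funB; first exact: IH'.
apply: measurable_funM.
  exact: (adaptedS G info_increasing i _ (adapted_eta i)).
apply: measurable_funB => //; apply: measurableT_comp => //.
apply: measurableT_comp => //; apply: measurable_funM => //.
apply: measurable_funB; last exact: IH'.
apply: measurable_funD => //.
by apply: (@measurable_fun_qmax _ (g_sigma_algebraType (G i.+1))) => b'; exact: IH'.
Qed.

Let residual s a t i w := r s a t + qmax a0 (q i w) t - q i w s a.

Lemma adapted_residual s a t i : adapted G i (residual s a t i).
Proof.
apply: measurable_funB; last exact: adapted_q.
apply: measurable_funD => //.
by apply: (@measurable_fun_qmax _ (g_sigma_algebraType (G i))) => b; exact: adapted_q.
Qed.

(** * Properties of almost every sample path *)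

Lemma ae_support : {ae P, forall w, forall i, 0 < p (ss i w) (aa i w) (ss' i w)}.
Proof.
apply: ae_foralln => i.
have : {ae P, forall w, forall x : St * A * St, p x.1.1 x.1.2 x.2 = 0 ->
    ~ trans_set x.1.1 x.1.2 x.2 i w}.
  apply: filter_forall => -[[s a] t] /=.
  have [pst|pst] := eqVneq (p s a t) 0; last by apply: aeW => w /eqP; rewrite (negbTE pst).
  exists (trans_set s a t i); split.
  - exact: info_measurable (info_trans s a t i).
  - have := cond_prob_visit s a t i setT (@measurableT _ (g_sigma_algebraType (G i))).
    by rewrite pst mul0e setTI.
  - by move=> w /= nw; apply: contrapT => h; apply: nw.
apply: filterS => w hw; rewrite lt_neqAle p0 andbT eq_sym; apply/negP => /eqP.
by move=> /(hw (ss i w, aa i w, ss' i w)); apply.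
Qed.

(* The hypothesis bounds the residual at the sampled successor only; a violation at
   another possible successor t would be known before sampling, and t would then be
   sampled with conditional probability p s a t > 0. *)
Lemma ae_residual_bounded : {ae P, forall w, forall i t,
  0 < p (ss i w) (aa i w) t -> zmin <= residual (ss i w) (aa i w) t i w <= zmax}.
Proof.
apply: ae_foralln => i.
have : {ae P, forall w, forall x : St * A * St, 0 < p x.1.1 x.1.2 x.2 ->
    visit_set x.1.1 x.1.2 i w -> zmin <= residual x.1.1 x.1.2 x.2 i w <= zmax}.
  apply: filter_forall => -[[s a] t] /=.
  have [pst|pst] := ltP 0 (p s a t); last by apply: aeW.
  pose B := visit_set s a i `&` residual s a t i @^-1` (~` `[zmin, zmax]).
  have iB : <<s G i >> B.
    apply: (@measurableI _ (g_sigma_algebraType (G i)) _ _ (info_visit s a i)).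
    have := adapted_residual s a t i measurableT _ (measurableC (measurable_itv `[zmin, zmax])).
    by rewrite setTI.
  have PB : P B = 0%E.
    have := cond_prob_visit s a t i B iB.
    (* When [t] is drawn, the residual at [t] is the observed one, so a violation lies in the null
       set of [z_bounded]. *)
    have -> : P (B `&` trans_set s a t i) = 0%E.
      have [N [mN PN subN]] := z_bounded.
      apply/eqP; rewrite -measure_le0 -PN; apply: le_measure; rewrite ?inE //.
        apply: measurableI; first exact: info_measurable iB.
        exact: info_measurable (info_trans s a t i).
      move=> w [[_ /= nz] [[/= su ab] st]]; apply: subN => /= /(_ i).
      rewrite /ziter su ab st => h; apply: nz; rewrite /= in_itv /=; exact: h.
    rewrite (_ : B `&` visit_set s a i = B); last first.
      by rewrite setIC setIA setIid.
    move=> /esym/eqP; rewrite mule_eq0 eqe gt_eqF //= => /eqP //.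
  exists B; split => //; first exact: info_measurable iB.
  move=> w /= nw; split; first by apply: contrapT => h; apply: nw => _ /h.
  by move=> /= hz; apply: nw => _ _; move: hz; rewrite /= in_itv.
apply: filterS => w hw t pt; exact: (hw (ss i w, aa i w, t) pt).
Qed.

Let stepw s a i w : R := step (ss^~ w) (aa^~ w) (eta^~ w) s a i.

Lemma ae_step_sum s a : {ae P, forall w, forall M, exists n, M <= series (stepw s a ^~ w) n}.
Proof.
apply: filterS (eta_sum s a) => w; apply: series_unbounded_of_eseries => i.
exact: eta_ge0.
Qed.

Lemma ae_step_sq s a : {ae P, forall w, exists K, forall n,
  series (fun i => stepw s a i w ^+ 2) n <= K}.
Proof.
apply: filterS (eta_sq s a) => w hw.
have [|K KP] := series_bounded_of_eseries _ _ _ hw; first by move=> i; exact: sqr_ge0.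
exists K => n; apply: le_trans (KP n); rewrite le_eqVlt; apply/orP; left; apply/eqP.
congr (series _ n); apply/funext => i; rewrite /stepw /step /visit.
by case: ifP => _; rewrite // expr0n.
Qed.

Let innovw s a t i w : R := innovation p (ss^~ w) (aa^~ w) (ss'^~ w) s a t i.
Let exp_residualw s a t i w : R :=
  exp_residual a0 r beta (ss^~ w) (aa^~ w) (ss'^~ w) (eta^~ w) s a t i.

Lemma visit_indic s a i w : (visit (ss^~ w) (aa^~ w) s a i)%:R = \1_(visit_set s a i) w :> R.
Proof.
rewrite indicE; congr (_%:R); congr nat_of_bool.
apply/idP/idP => [/andP [/eqP su /eqP ab]|]; first exact/mem_set.
by rewrite inE => -[/= su ab]; rewrite /visit su ab !eqxx.
Qed.

Lemma innovation_mdiff s a t i w :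
  innovw s a t i w = mdiff (trans_set s a t) (visit_set s a) (p s a t) i w.
Proof.
rewrite /innovw /innovation visit_indic /mdiff; congr (_ - _).
rewrite indicE; congr (_%:R); congr nat_of_bool.
apply/idP/idP => [/andP [/andP [/eqP su /eqP ab] /eqP st]|]; first exact/mem_set.
by rewrite inE => -[[/= su ab] /= st]; rewrite /visit su ab st !eqxx.
Qed.

Lemma adapted_step s a i : adapted G i (stepw s a i).
Proof.
rewrite /adapted (_ : stepw s a i = (fun w => \1_(visit_set s a i) w * eta i w)).
  apply: measurable_funM; last exact: adapted_eta.
  exact: (@measurable_indic _ (g_sigma_algebraType (G i)) R setT _ (info_visit s a i)).
apply/funext => w; rewrite -visit_indic /stepw /step.
by case: ifP => _; rewrite ?mul1r ?mul0r.
Qed.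

(** At visits the exponential weight is at most exp (- beta zmin), so square-summable steps give
    square-summable weights. That bound needs [p s a t > 0]; otherwise [t] is almost surely never
    drawn from [(s, a)] and the innovations vanish. *)
Lemma ae_noise_cvg s a t : {ae P, forall w,
  cvgn (series (fun i => stepw s a i w * exp_residualw s a t i w * innovw s a t i w))}.
Proof.
have [pst|pst] := ltP 0 (p s a t); last first.
  have pst0 : p s a t = 0 by apply/eqP; rewrite eq_le pst p0.
  apply: filterS ae_support => w hw.
  rewrite (_ : series _ = cst 0); first exact: is_cvg_cst.
  apply/funext => n; rewrite /series /= big1 // => i _.
  rewrite /innovw /innovation pst0 mul0r subr0.
  case: (boolP (_ && _)) => [/andP [/andP [/eqP su /eqP ab] /eqP st]|_]; last by rewrite mulr0.
  by have := hw i; rewrite su ab st pst0 ltxx.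
suff : {ae P, forall w, cvgn (series (fun i => stepw s a i w * exp_residualw s a t i w *
    mdiff (trans_set s a t) (visit_set s a) (p s a t) i w))}.
  apply: filterS => w; rewrite (_ : (fun i => _) = (fun i =>
    stepw s a i w * exp_residualw s a t i w * innovw s a t i w)) //.
  by apply/funext => i; rewrite innovation_mdiff.
have pst1 : p s a t <= 1.
  by rewrite -(p1 s a) (bigD1 t) //= lerDl; exact: sumr_ge0.
apply: (ae_cvg_martingale_transform P G info_measurable info_increasing
  (trans_set s a t) (visit_set s a) (p s a t)) => //.
- by move=> i w [].
- by move=> i; exact: info_visit.
- by move=> i; exact: info_trans.
- by move=> i B; exact: cond_prob_visit.
- move=> i; apply: measurable_funM; first exact: adapted_step.
  apply: measurableT_comp => //; apply: measurableT_comp => //.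
  by apply: measurable_funM => //; exact: adapted_residual.
apply: filterS2 (ae_step_sq s a) ae_residual_bounded => w [K KP] hz.
exists (K * expR (- (beta * zmin)) ^+ 2) => n.
apply: le_trans (ler_wpM2r (sqr_ge0 _) (KP n)).
rewrite /series /= mulr_suml; apply: ler_sum => i _; rewrite exprMn.
rewrite /stepw /step; case: ifP => [|_]; last by rewrite expr0n !mul0r.
move=> /andP [/eqP su /eqP ab]; apply: ler_wpM2l; first exact: sqr_ge0.
rewrite ler_pXn2r ?nnegrE ?expR_ge0 // ler_expR lerN2 ler_pM2l //.
by have := hz i t; rewrite su ab => /(_ pst) /andP [].
Qed.

Lemma ae_qiter_cvg : {ae P, forall w, exists qinf : St -> A -> R,
  [/\ forall s a, expect_exp a0 p r beta qinf s a = 1,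
      forall a, qinf e a = 0 &
      forall s a, q i w s a @[i --> \oo] --> qinf s a]}.
Proof.
have fsum : {ae P, forall w, forall x : St * A,
    forall M, exists n, M <= series (stepw x.1 x.2 ^~ w) n}.
  by apply: filter_forall => x; exact: ae_step_sum.
have fsq : {ae P, forall w, forall x : St * A, exists K, forall n,
    series (fun i => stepw x.1 x.2 i w ^+ 2) n <= K}.
  by apply: filter_forall => x; exact: ae_step_sq.
have fnoise : {ae P, forall w, forall x : St * A * St, cvgn (series (fun i =>
    stepw x.1.1 x.1.2 i w * exp_residualw x.1.1 x.1.2 x.2 i w * innovw x.1.1 x.1.2 x.2 i w))}.
  by apply: filter_forall => x; exact: ae_noise_cvg.
apply: filterS3 (filterI fsum fsq) fnoise (filterI ae_support ae_residual_bounded).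
move=> w [hsum hsq] hnoise [hsupp hres].
apply: (qiter_cvg a0 e p r beta zmin zmax (ss^~ w) (aa^~ w) (ss'^~ w) (eta^~ w)) => //.
- by move=> s a; exact: (hsum (s, a)).
- by move=> s a; exact: (hsq (s, a)).
- by move=> s a t; exact: (hnoise (s, a, t)).
Qed.

End q_learning.

Theorem mainTheorem5 (R : realType) (St A : finType) (e : St) (a0 : A)
  (p r : St -> A -> St -> R) (beta : R)
  (d : measure_display) (Omega : measurableType d) (P : probability Omega R)
  (ss : nat -> Omega -> St) (aa : nat -> Omega -> A)
  (ss' : nat -> Omega -> St) (eta : nat -> Omega -> R)
  (zmin zmax : R) :
  transient_MDP p r e ->
  0 < beta ->
  (* random samples / step sizes are random variables *)
  (forall i x, measurable (ss i @^-1` [set x])) ->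
  (forall i x, measurable (aa i @^-1` [set x])) ->
  (forall i x, measurable (ss' i @^-1` [set x])) ->
  (forall i, measurable_fun setT (eta i)) ->
  (forall i w, 0 <= eta i w) ->
  (* P[s'_i = s' | G_{i-1}, s_i, a_i, eta_i] = p(s_i, a_i, s') a.s. *)
  (forall i s' B, info_sigma ss aa ss' eta i B ->
     P (B `&` (ss' i @^-1` [set s'])) =
     (\int[P]_(w in B) (p (ss i w) (aa i w) s')%:E)%E) ->
  (forall s a, {ae P, forall w,
     (\sum_(i <oo | (ss i w == s) && (aa i w == a)) (eta i w)%:E = +oo)%E}) ->
  (forall s a, {ae P, forall w,
     (\sum_(i <oo | (ss i w == s) && (aa i w == a)) ((eta i w) ^+ 2)%:E < +oo)%E}) ->
  zmin <= zmax ->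
  {ae P, forall w, forall i,
     zmin <= ziter a0 r beta (ss^~ w) (aa^~ w) (ss'^~ w) (eta^~ w) i <= zmax} ->
  exists qinf : St -> A -> R,
    Bhat_fixed_point a0 p r beta qinf /\
    {ae P, forall w, forall s a,
       qiter a0 r beta (ss^~ w) (aa^~ w) (ss'^~ w) (eta^~ w) i s a
         @[i --> \oo] --> qinf s a}.
Proof.
move=> tr b0 mss maa mss' meta eta0 cond esum esq _ zb.
have good := ae_qiter_cvg e a0 p r beta P ss aa ss' eta zmin zmax tr b0 mss maa mss'
  meta eta0 cond esum esq zb.
(* The limit along one good path is the candidate; a good path exists because the whole space is not
   null. *)
have [w0 [qinf [E1 qe _]]] : exists w0, exists qinf : St -> A -> R,
  [/\ forall s a, expect_exp a0 p r beta qinf s a = 1,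
      forall a, qinf e a = 0 &
      forall s a, qiter a0 r beta (ss^~ w0) (aa^~ w0) (ss'^~ w0) (eta^~ w0) i s a
         @[i --> \oo] --> qinf s a].
  apply: contrapT => /forallNP none; have [N [mN PN subN]] := good.
  have NT : N = setT by apply/seteqP; split => // w _; apply: subN; exact: none.
  by move: PN; rewrite NT probability_setT => /eqP; rewrite onee_eq0.
exists qinf; split.
  by apply: Bhat_fixed_of_expect_exp => //; have [] := tr.
apply: filterS good => w [qw [E1' qe' cvgw]] s a.
suff -> : qinf s a = qw s a by exact: cvgw.
(* Both limits have [expect_exp] equal to 1 and vanish at the sink, so the comparison applies in
   both directions. *)
apply/eqP; rewrite eq_le; apply/andP; split.
  apply: (sub_le_super a0 p r e beta) => // [s1 a1|s1 a1|a1];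
    by rewrite ?E1 ?E1' ?qe ?qe'.
apply: (sub_le_super a0 p r e beta) => // [s1 a1|s1 a1|a1];
  by rewrite ?E1 ?E1' ?qe ?qe'.
Qed.
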